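(* Let $\mathfrak{a}$ and $\mathfrak{b}$ be $\mathbb{Z}$-algebras with tails topologies $\mathcal{T}_{\mathfrak{a}}$ and $\mathcal{T}_{\mathfrak{b}}$, and let $\mathfrak{c} = (\mathfrak{a} \otimes \mathfrak{b})_{\Delta}$ be the diagonal $\mathbb{Z}$-algebra with tails topology $\mathcal{T}_{\mathfrak{c}}$. Then the functor $$\Delta : (\mathfrak{c}, \mathcal{T}_{\mathfrak{c}}) \to (\mathfrak{a} \otimes \mathfrak{b}, \mathcal{T}_{\mathfrak{a}} \boxtimes \mathcal{T}_{\mathfrak{b}}), \quad n \mapsto (n,n)$$ is cocontinuous, and $\Delta^{-1}(\mathcal{T}_{\mathfrak{a}} \boxtimes \mathcal{T}_{\mathfrak{b}}) \subseteq \mathcal{T}_{\mathfrak{c}}$.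
   Context: $k$ is a commutative ring. The tensor product $\mathfrak{a} \otimes \mathfrak{b}$ of $k$-linear categories has objects the pairs $(A,B)$ and $(\mathfrak{a} \otimes \mathfrak{b})((A',B'),(A,B)) = \mathfrak{a}(A',A) \otimes_k \mathfrak{b}(B',B)$. A sieve on $A \in \mathfrak{a}$ is a submodule $R \subseteq \mathfrak{a}(-,A)$ (of the $k$-linear functor $\mathfrak{a}(-,A) : \mathfrak{a}^{\mathrm{op}} \to \mathrm{Mod}(k)$); for $f : A' \to A$, $f^{-1}R = \{g \mid fg \in R\}$. A (linear) topology $\mathcal{T}$ on $\mathfrak{a}$ specifies for every $A$ a collection $\mathcal{T}(A)$ of (covering) sieves on $A$ such that: $\mathfrak{a}(-,A) \in \mathcal{T}(A)$ (identity); $R \in \mathcal{T}(A)$ and $f : A' \to A$ imply $f^{-1}R \in \mathcal{T}(A')$ (pullback); if $R \in \mathcal{T}(A)$ and $S$ is a sieve on $A$ with $f^{-1}S \in \mathcal{T}(A')$ for all $f \in R(A')$, then $S \in \mathcal{T}(A)$ (glueing). For sieves $R$ on $A$ and $S$ on $B$, $R \boxtimes S$ is the image of $R \otimes S \to (\mathfrak{a} \otimes \mathfrak{b})(-,(A,B))$, where $(R\otimes S)(A',B') = R(A')\otimes_k S(B')$. $\mathcal{T}_{\mathfrak{a}} \boxtimes \mathcal{T}_{\mathfrak{b}}$ is the smallest topology on $\mathfrak{a} \otimes \mathfrak{b}$ containing all sieves $R \boxtimes \mathfrak{b}(-,B)$ with $R \in \mathcal{T}_{\mathfrak{a}}(A)$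 and all $\mathfrak{a}(-,A) \boxtimes S$ with $S \in \mathcal{T}_{\mathfrak{b}}(B)$. A $\mathbb{Z}$-algebra is a $k$-linear category $\mathfrak{a}$ with object set $\mathbb{Z}$, assumed positively graded: $\mathfrak{a}(n,m) = 0$ for $n < m$. For $n \geq m$, $\mathfrak{a}(-,m)_{\geq n} \subseteq \mathfrak{a}(-,m)$ is the sieve with value $\mathfrak{a}(l,m)$ at $l \geq n$ and $0$ otherwise. The tails topology on $\mathfrak{a}$ is the smallest topology containing all sieves $\mathfrak{a}(-,m)_{\geq n}$, $n \geq m$. The diagonal $\mathbb{Z}$-algebra $(\mathfrak{a} \otimes \mathfrak{b})_{\Delta}$ has $(\mathfrak{a} \otimes \mathfrak{b})_{\Delta}(n,m) = (\mathfrak{a} \otimes \mathfrak{b})((n,n),(m,m)) = \mathfrak{a}(n,m) \otimes_k \mathfrak{b}(n,m)$, and $\Delta$ is the resulting fully faithful functor. For a functor $\phi : \mathfrak{c} \to \mathfrak{d}$ and a sieve $S$ on $C$, $\phi S$ is the sieve on $\phi(C)$ generated by all $\phi(f)$, $f \in S$. $\phi : (\mathfrak{c}, \mathcal{T}_{\mathfrak{c}}) \to (\mathfrak{d}, \mathcal{T}_{\mathfrak{d}})$ is cocontinuous if for every $C \in \mathfrak{c}$ and $R \in \mathcal{T}_{\mathfrak{d}}(\phi(C))$ there exists $S \in \mathcal{T}_{\mathfrak{c}}(C)$ with $\phi S \subseteq R$. A sieve $S$ on $C$ is in $\phi^{-1}\mathcal{T}_{\mathfrak{d}}(C)$ iff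 $\phi S \in \mathcal{T}_{\mathfrak{d}}(\phi(C))$. *)

(* Defs.v *)
From HB Require Import structures.
From mathcomp Require Import all_boot all_order all_algebra.
From mathcomp Require Import boolp.

Set Implicit Arguments.
Unset Strict Implicit.
Unset Printing Implicit Defensive.

Import Order.TTheory GRing.Theory Num.Theory.

Local Open Scope ring_scope.
Local Open Scope quotient_scope.

Section Submodule.
Variables (k : pzRingType) (V : lmodType k).

Section OfProp.
Variable P : V -> Prop.
Hypothesis (P0 : P 0) (PL : forall a u v, P u -> P v -> P (a *: u + v)).

Lemma submod_of_closed : submod_closed (fun v : V => `[< P v >]).
Proof.
split; first by apply/asboolP.
by move=> a u v /asboolP Pu /asboolP Pv; apply/asboolP/PL.
Qed.

Definition submod_of : submodClosed V :=
  HB.pack (fun v : V => `[< P v >])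
    (GRing.isSubmodClosed.Build k V (fun v : V => `[< P v >]) submod_of_closed).

Lemma submod_ofP v : reflect (P v) (v \in submod_of).
Proof. exact: asboolP. Qed.

End OfProp.

Lemma submod_ext (S S' : submodClosed V) : S =i S' -> S = S'.
Proof.
case: S S' => [S [[SD] [SZ]]] [S' [[SD'] [SZ']]] eqS.
have {}eqS : S = S' by apply/funext=> v; exact: eqS.
by subst S'; rewrite (Prop_irrelevance SD SD') (Prop_irrelevance SZ SZ').
Qed.

Record submod (S : submodClosed V) := Submod {
  submod_val : V;
  submod_valP : submod_val \in S
}.

HB.instance Definition _ S := [isSub for @submod_val S].
HB.instance Definition _ S := [Choice of submod S by <:].
HB.instance Definition _ S := [SubChoice_isSubLmodule of submod S by <:].

End Submodule.

Section LinearPred.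
Variables (k : pzRingType) (V W : lmodType k) (f : V -> W).
Hypothesis f_lin : linear f.

Lemma lin0 : f 0 = 0.
Proof. by have := f_lin (-1) 0 0; rewrite scaler0 addr0 scaleN1r addNr. Qed.

Lemma linD u v : f (u + v) = f u + f v.
Proof. by have := f_lin 1 u v; rewrite !scale1r. Qed.

Lemma linZ r u : f (r *: u) = r *: f u.
Proof. by have := f_lin r u 0; rewrite lin0 !addr0. Qed.

End LinearPred.

(* Tensor product of modules over a commutative ring.  An element is a finite *)
(* formal sum of pairs, modulo the congruence generated by bilinearity; the   *)
(* universal property is tensor_lift_linear, tensor_lift_tens and             *)
(* tensor_lift_unique below.                                                  *)
Section Tensor.
Variables (k : comPzRingType) (U V : lmodType k).

Inductive tensor_eq : seq (U * V) -> seq (U * V) -> Prop :=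
| tensor_eq_refl s : tensor_eq s s
| tensor_eq_sym s t : tensor_eq s t -> tensor_eq t s
| tensor_eq_trans s t r : tensor_eq s t -> tensor_eq t r -> tensor_eq s r
| tensor_eq_cat s s' t t' :
    tensor_eq s s' -> tensor_eq t t' -> tensor_eq (s ++ t) (s' ++ t')
| tensor_eq_catC s t : tensor_eq (s ++ t) (t ++ s)
| tensor_eq0l v : tensor_eq [:: (0, v)] [::]
| tensor_eqDl u u' v : tensor_eq [:: (u + u', v)] [:: (u, v); (u', v)]
| tensor_eqDr u v v' : tensor_eq [:: (u, v + v')] [:: (u, v); (u, v')]
| tensor_eqZ a u v : tensor_eq [:: (a *: u, v)] [:: (u, a *: v)].

Definition tensor_rel (s t : seq (U * V)) : bool := `[< tensor_eq s t >].

Lemma tensor_rel_equiv : equiv_class_of tensor_rel.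
Proof.
split=> [s|s t|t s r].
- by apply/asboolP; constructor.
- by apply/asboolP/asboolP; apply: tensor_eq_sym.
- move=> /asboolP st /asboolP tr; apply/asboolP; exact: tensor_eq_trans st tr.
Qed.

Canonical tensor_equiv := EquivRelPack tensor_rel_equiv.
Canonical tensor_encModRel := defaultEncModRel tensor_rel.

Definition tensor := {eq_quot tensor_rel}.
HB.instance Definition _ := EqQuotient.on tensor.
HB.instance Definition _ := Choice.on tensor.

Lemma tensor_piP s t : \pi_tensor s = \pi_tensor t <-> tensor_eq s t.
Proof.
split=> [/eqP|st]; first by rewrite piE => /asboolP.
by apply/eqP; rewrite piE; apply/asboolP.
Qed.

Definition fscale (a : k) (s : seq (U * V)) := [seq (a *: p.1, p.2) | p <- s].

Lemma fscale_eq a s t : tensor_eq s t -> tensor_eq (fscale a s) (fscale a t).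
Proof.
elim=> {s t}.
- by move=> s; constructor.
- by move=> s t _; apply: tensor_eq_sym.
- by move=> s t r _ st _; apply: tensor_eq_trans st.
- by move=> s s' t t' _ ss' _ tt'; rewrite /fscale !map_cat; apply: tensor_eq_cat.
- by move=> s t; rewrite /fscale !map_cat; apply: tensor_eq_catC.
- by move=> v /=; rewrite scaler0; apply: tensor_eq0l.
- by move=> u u' v /=; rewrite scalerDr; apply: tensor_eqDl.
- by move=> u v v' /=; apply: tensor_eqDr.
- by move=> b u v /=; rewrite scalerA mulrC -scalerA; apply: tensor_eqZ.
Qed.

Definition tensor_zero : tensor := \pi_tensor [::].
Definition tensor_add (x y : tensor) : tensor := \pi_tensor (repr x ++ repr y).
Definition tensor_scale (a : k) (x : tensor) : tensor :=
  \pi_tensor (fscale a (repr x)).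
Definition tensor_opp (x : tensor) : tensor := tensor_scale (-1) x.

Lemma tensor_repr s : tensor_eq (repr (\pi_tensor s)) s.
Proof. by apply/tensor_piP; rewrite reprK. Qed.

Lemma tensorW (P : tensor -> Prop) :
  (forall s, P (\pi_tensor s)) -> forall x, P x.
Proof. by move=> Ps x; rewrite -[x]reprK. Qed.

Lemma tensor_addE s t :
  tensor_add (\pi_tensor s) (\pi_tensor t) = \pi_tensor (s ++ t).
Proof. by apply/tensor_piP; apply: tensor_eq_cat; apply: tensor_repr. Qed.

Lemma tensor_scaleE a s : tensor_scale a (\pi_tensor s) = \pi_tensor (fscale a s).
Proof. by apply/tensor_piP; apply: fscale_eq; apply: tensor_repr. Qed.

Lemma tensor_addA : associative tensor_add.
Proof. by move=> x y z; elim/tensorW: x => s; elim/tensorW: y => t; elim/tensorW: z => r; rewrite !tensor_addE catA. Qed.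

Lemma tensor_addC : commutative tensor_add.
Proof.
elim/tensorW=> s; elim/tensorW=> t; rewrite !tensor_addE.
by apply/tensor_piP; apply: tensor_eq_catC.
Qed.

Lemma tensor_add0 : left_id tensor_zero tensor_add.
Proof. by elim/tensorW=> s; rewrite tensor_addE. Qed.

Lemma fscaleDl a b s :
  tensor_eq (fscale (a + b) s) (fscale a s ++ fscale b s).
Proof.
elim: s => [|[u v] s IHs]; first by constructor.
rewrite /= scalerDl.
have -> : forall (p : U * V) q, p :: q = [:: p] ++ q by [].
have E : tensor_eq ([:: (a *: u, v); (b *: u, v)] ++ (fscale a s ++ fscale b s))
    ((a *: u, v) :: fscale a s ++ (b *: u, v) :: fscale b s).
  rewrite -[X in tensor_eq X _]/([:: (a *: u, v)] ++ ([:: (b *: u, v)] ++ (fscale a s ++ fscale b s))).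
  rewrite -[X in tensor_eq _ X]/([:: (a *: u, v)] ++ (fscale a s ++ ([:: (b *: u, v)] ++ fscale b s))).
  apply: tensor_eq_cat; first by constructor.
  rewrite !catA; apply: tensor_eq_cat; last by constructor.
  exact: tensor_eq_catC.
apply: tensor_eq_trans E; apply: tensor_eq_cat IHs.
exact: tensor_eqDl.
Qed.

Lemma fscale0 s : tensor_eq (fscale 0 s) [::].
Proof.
elim: s => [|[u v] s IHs] /=; first by constructor.
rewrite scale0r -[X in tensor_eq _ X]/([::] ++ [::]) -cat1s.
apply: tensor_eq_cat IHs; exact: tensor_eq0l.
Qed.

Lemma fscale1 s : fscale 1 s = s.
Proof. by rewrite /fscale -[RHS]map_id; apply: eq_map => -[u v]; rewrite scale1r. Qed.

Lemma tensor_addN : left_inverse tensor_zero tensor_opp tensor_add.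
Proof.
elim/tensorW=> s; rewrite /tensor_opp tensor_scaleE tensor_addE; apply/tensor_piP.
rewrite -[X in _ ++ X]fscale1.
apply: tensor_eq_trans (tensor_eq_sym (fscaleDl (-1) 1 s)) _.
by rewrite addNr; apply: fscale0.
Qed.

HB.instance Definition _ :=
  GRing.isZmodule.Build tensor tensor_addA tensor_addC tensor_add0 tensor_addN.

Lemma tensor_scaleA a b x :
  tensor_scale a (tensor_scale b x) = tensor_scale (a * b) x.
Proof.
elim/tensorW: x => s; rewrite !tensor_scaleE /fscale -map_comp.
by congr (\pi_tensor _); apply: eq_map => p /=; rewrite scalerA.
Qed.

Lemma tensor_scale1 : left_id 1 tensor_scale.
Proof. by elim/tensorW=> s; rewrite tensor_scaleE fscale1. Qed.

Lemma tensor_scaleDr : right_distributive tensor_scale +%R.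
Proof.
move=> a; elim/tensorW=> s; elim/tensorW=> t; rewrite /GRing.add /=.
by rewrite !(tensor_addE, tensor_scaleE) /fscale map_cat.
Qed.

Lemma tensor_scaleDl x : {morph tensor_scale^~ x : a b / a + b}.
Proof.
move=> a b; elim/tensorW: x => s; rewrite [RHS]/GRing.add /=.
rewrite !tensor_scaleE tensor_addE; apply/tensor_piP; exact: fscaleDl.
Qed.

HB.instance Definition _ := GRing.Zmodule_isLmodule.Build k tensor
  tensor_scaleA tensor_scale1 tensor_scaleDr tensor_scaleDl.

Definition tens (u : U) (v : V) : tensor := \pi_tensor [:: (u, v)].

Lemma tensor_piE s : \pi_tensor s = \sum_(p <- s) tens p.1 p.2.
Proof.
elim: s => [|[u v] s IHs]; first by rewrite big_nil.
by rewrite big_cons -IHs /GRing.add /= tensor_addE.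
Qed.

Lemma tensor_sum (x : tensor) : x = \sum_(p <- repr x) tens p.1 p.2.
Proof. by rewrite -tensor_piE reprK. Qed.

Lemma tensor_ind (P : tensor -> Prop) :
    P 0 -> (forall x y, P x -> P y -> P (x + y)) ->
    (forall u v, P (tens u v)) -> forall x, P x.
Proof.
move=> P0 PD Pt x; rewrite (tensor_sum x).
by apply: (big_ind P) => // p _; apply: Pt.
Qed.

Definition is_bilinear (W : lmodType k) (f : U -> V -> W) :=
  (forall v, linear (f^~ v)) /\ (forall u, linear (f u)).

Lemma tens_scalel a u v : tens (a *: u) v = a *: tens u v.
Proof. by rewrite /GRing.scale /= tensor_scaleE. Qed.

Lemma tens_bilinear : is_bilinear tens.
Proof.
have D s t : \pi_tensor s + \pi_tensor t = \pi_tensor (s ++ t).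
  exact: tensor_addE.
split=> [v a u u'|u a v v'].
  by rewrite -tens_scalel D; apply/tensor_piP; apply: tensor_eqDl.
rewrite -tens_scalel D; apply/tensor_piP.
apply: tensor_eq_trans (tensor_eqDr _ _ _) _.
rewrite -[X in tensor_eq X _]/([:: (u, a *: v)] ++ [:: (u, v')]).
by apply: tensor_eq_cat; [apply/tensor_eq_sym/tensor_eqZ | constructor].
Qed.

Section Lift.
Variables (W : lmodType k) (f : U -> V -> W).

Definition tensor_lift (x : tensor) : W := \sum_(p <- repr x) f p.1 p.2.

Hypothesis f_bil : is_bilinear f.

Lemma bil0l v : f 0 v = 0.
Proof. exact: lin0 (f_bil.1 v). Qed.

Lemma bilDl u u' v : f (u + u') v = f u v + f u' v.
Proof. exact: linD (f_bil.1 v) u u'. Qed.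

Lemma bilDr u v v' : f u (v + v') = f u v + f u v'.
Proof. exact: linD (f_bil.2 u) v v'. Qed.

Lemma bilZl a u v : f (a *: u) v = a *: f u v.
Proof. exact: linZ (f_bil.1 v) a u. Qed.

Lemma bilZr a u v : f u (a *: v) = a *: f u v.
Proof. exact: linZ (f_bil.2 u) a v. Qed.

Lemma tensor_eq_lift s t : tensor_eq s t ->
  \sum_(p <- s) f p.1 p.2 = \sum_(p <- t) f p.1 p.2.
Proof.
elim=> {s t} //.
- by move=> s t r _ -> _ ->.
- by move=> s s' t t' _ ss' _ tt'; rewrite !big_cat /= ss' tt'.
- by move=> s t; rewrite !big_cat /= addrC.
- by move=> v; rewrite big_seq1 big_nil /= bil0l.
- by move=> u u' v; rewrite big_seq1 big_cons big_seq1 /= bilDl.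
- by move=> u v v'; rewrite big_seq1 big_cons big_seq1 /= bilDr.
- by move=> a u v; rewrite !big_seq1 /= bilZl bilZr.
Qed.

Lemma tensor_lift_pi s : tensor_lift (\pi_tensor s) = \sum_(p <- s) f p.1 p.2.
Proof. exact/tensor_eq_lift/tensor_repr. Qed.

Lemma tensor_lift_tens u v : tensor_lift (tens u v) = f u v.
Proof. by rewrite tensor_lift_pi big_seq1. Qed.

Lemma tensor_lift_linear : linear tensor_lift.
Proof.
move=> a; elim/tensorW=> s; elim/tensorW=> t.
have -> : a *: \pi_tensor s + \pi_tensor t = \pi_tensor (fscale a s ++ t).
  by rewrite /GRing.add /GRing.scale /= tensor_scaleE tensor_addE.
rewrite !tensor_lift_pi big_cat big_map scaler_sumr /=; congr (_ + _).
by apply: eq_bigr => p _; rewrite bilZl.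
Qed.

Lemma tensor_lift_unique (g : tensor -> W) :
  linear g -> (forall u v, g (tens u v) = f u v) -> g =1 tensor_lift.
Proof.
move=> g_lin g_tens x.
rewrite {1}(tensor_sum x) /tensor_lift.
by elim: (repr x) => [|p s IHs]; rewrite ?big_nil ?(lin0 g_lin) // !big_cons (linD g_lin) IHs g_tens.
Qed.

End Lift.

Lemma tensor_lift_param_linear (I : lmodType k) (W : lmodType k)
    (f : I -> U -> V -> W) x :
  (forall u v, linear (fun i => f i u v)) -> linear (fun i => tensor_lift (f i) x).
Proof.
move=> f_lin a i j; rewrite /tensor_lift scaler_sumr -big_split /=.
by apply: eq_bigr => p _; rewrite f_lin.
Qed.

End Tensor.

Arguments tens {k U V} u v.

Definition tensor_map (k : comPzRingType) (U V U' V' : lmodType k)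
    (f : U -> U') (g : V -> V') : tensor U V -> tensor U' V' :=
  tensor_lift (fun u v => tens (f u) (g v)).

Lemma tens_map_bilinear (k : comPzRingType) (U V U' V' : lmodType k)
    (f : {linear U -> U'}) (g : {linear V -> V'}) :
  is_bilinear (fun u v => tens (f u) (g v)).
Proof.
split=> [v a u u'|u a v v']; rewrite linearP;
  [exact: (tens_bilinear _ _).1 | exact: (tens_bilinear _ _).2].
Qed.

(* k-linear categories with set of objects O; mor c A B is the module of      *)
(* morphisms from A to B, written c(A, B).                                    *)
Record lincat (k : comPzRingType) (O : Type) := LinCat {
  mor : O -> O -> lmodType k;
  idm : forall A, mor A A;
  mcomp : forall A B C, mor B C -> mor A B -> mor A C;
  mcomp_linearl : forall A B C (g : mor A B), linear (fun f : mor B C => mcomp f g);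
  mcomp_linearr : forall A B C (f : mor B C), linear (fun g : mor A B => mcomp f g);
  mcomp_idl : forall A B (f : mor A B), mcomp (idm B) f = f;
  mcomp_idr : forall A B (f : mor A B), mcomp f (idm A) = f;
  mcompA : forall A B C D (f : mor C D) (g : mor B C) (h : mor A B),
    mcomp f (mcomp g h) = mcomp (mcomp f g) h
}.

Arguments mor {k O} c A B : rename.
Arguments idm {k O} c A : rename.
Arguments mcomp {k O} c {A B C} f g : rename.

Section LincatTheory.
Variables (k : comPzRingType) (O : Type) (c : lincat k O).

Lemma mcompDl A B C (f f' : mor c B C) (g : mor c A B) :
  mcomp c (f + f') g = mcomp c f g + mcomp c f' g.
Proof. exact: (linD (@mcomp_linearl _ _ c A B C g)). Qed.

Lemma mcompDr A B C (f : mor c B C) (g g' : mor c A B) :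
  mcomp c f (g + g') = mcomp c f g + mcomp c f g'.
Proof. exact: (linD (mcomp_linearr f)). Qed.

Lemma mcomp0m A B C (g : mor c A B) : mcomp c (0 : mor c B C) g = 0.
Proof. exact: (lin0 (@mcomp_linearl _ _ c A B C g)). Qed.

Lemma mcompm0 A B C (f : mor c B C) : mcomp c f (0 : mor c A B) = 0.
Proof. exact: (lin0 (mcomp_linearr f)). Qed.

End LincatTheory.

Section LinFunctor.
Variables (k : comPzRingType) (O P : Type).

Record linfunctor (c : lincat k O) (d : lincat k P) := LinFunctor {
  fob :> O -> P;
  fmor : forall A B, mor c A B -> mor d (fob A) (fob B);
  fmor_linear : forall A B, linear (@fmor A B);
  fmor_id : forall A, fmor (idm c A) = idm d (fob A);
  fmor_comp : forall A B C (f : mor c B C) (g : mor c A B),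
    fmor (mcomp c f g) = mcomp d (fmor f) (fmor g)
}.

Variables (phi : O -> P) (d : lincat k P).

Definition full_restr : lincat k O := {|
  mor := fun A B => mor d (phi A) (phi B);
  idm := fun A => idm d (phi A);
  mcomp := fun A B C f g => mcomp d f g;
  mcomp_linearl := fun A B C => @mcomp_linearl k P d (phi A) (phi B) (phi C);
  mcomp_linearr := fun A B C => @mcomp_linearr k P d (phi A) (phi B) (phi C);
  mcomp_idl := fun A B => @mcomp_idl k P d (phi A) (phi B);
  mcomp_idr := fun A B => @mcomp_idr k P d (phi A) (phi B);
  mcompA := fun A B C D => @mcompA k P d (phi A) (phi B) (phi C) (phi D)
|}.

Definition full_restr_functor : linfunctor full_restr d.
Proof.
by exists phi (fun A B (f : mor full_restr A B) => f).
Defined.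

End LinFunctor.

Arguments fmor {k O P c d} F {A B} f : rename.

Section TensorCat.
Variables (k : comPzRingType) (O P : Type) (a : lincat k O) (b : lincat k P).

Implicit Types X Y Z T : (O * P)%type.

Let thom X Y : lmodType k :=
  GRing.Lmodule.clone k (tensor (mor a X.1 Y.1) (mor b X.2 Y.2)) _.

(* the composition of tensor_cat is determined by                             *)
(* (f (x) g) o (f' (x) g') = (f o f') (x) (g o g'), see tensor_compE          *)
Definition tensor_comp X Y Z (x : thom Y Z) (y : thom X Y) : thom X Z :=
  tensor_lift (fun f g =>
    tensor_lift (fun f' g' => tens (mcomp a f f') (mcomp b g g')) y) x.

Let inner_bil X Y Z (f : mor a Y.1 Z.1) (g : mor b Y.2 Z.2) :
  is_bilinear (fun (f' : mor a X.1 Y.1) (g' : mor b X.2 Y.2) =>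
    tens (mcomp a f f') (mcomp b g g')).
Proof.
split=> [g' r f' f''|f' r g' g''].
  by rewrite mcomp_linearr; apply: (tens_bilinear _ _).1.
by rewrite mcomp_linearr; apply: (tens_bilinear _ _).2.
Qed.

Let outer_bil X Y Z (y : thom X Y) :
  is_bilinear (fun (f : mor a Y.1 Z.1) (g : mor b Y.2 Z.2) =>
    tensor_lift (fun f' g' => tens (mcomp a f f') (mcomp b g g')) y).
Proof.
split=> [g|f]; apply: tensor_lift_param_linear => f' g' r h h'.
  by rewrite mcomp_linearl; apply: (tens_bilinear _ _).1.
by rewrite mcomp_linearl; apply: (tens_bilinear _ _).2.
Qed.

Lemma tensor_compE X Y Z (f : mor a Y.1 Z.1) (g : mor b Y.2 Z.2)
    (f' : mor a X.1 Y.1) (g' : mor b X.2 Y.2) :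
  tensor_comp (tens f g : thom Y Z) (tens f' g' : thom X Y)
    = tens (mcomp a f f') (mcomp b g g').
Proof.
rewrite /tensor_comp tensor_lift_tens; last exact: outer_bil.
by rewrite tensor_lift_tens //; apply: inner_bil.
Qed.

Lemma tensor_comp_linearl X Y Z (y : thom X Y) :
  linear (fun x : thom Y Z => tensor_comp x y).
Proof. exact: tensor_lift_linear (outer_bil _ y). Qed.

Lemma tensor_comp_linearr X Y Z (x : thom Y Z) : linear (@tensor_comp X Y Z x).
Proof.
apply: tensor_lift_param_linear => f g.
exact: (tensor_lift_linear (@inner_bil X Y Z f g)).
Qed.

Let tcompDl X Y Z (y : thom X Y) (x x' : thom Y Z) :
  tensor_comp (x + x') y = tensor_comp x y + tensor_comp x' y.
Proof. exact: (linD (@tensor_comp_linearl X Y Z y)). Qed.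

Let tcompDr X Y Z (x : thom Y Z) (y y' : thom X Y) :
  tensor_comp x (y + y') = tensor_comp x y + tensor_comp x y'.
Proof. exact: (linD (tensor_comp_linearr x)). Qed.

Let tcomp0l X Y Z (y : thom X Y) : tensor_comp (0 : thom Y Z) y = 0.
Proof. exact: (lin0 (@tensor_comp_linearl X Y Z y)). Qed.

Let tcomp0r X Y Z (x : thom Y Z) : tensor_comp x (0 : thom X Y) = 0.
Proof. exact: (lin0 (tensor_comp_linearr x)). Qed.

Definition tensor_idm X : thom X X := tens (idm a X.1) (idm b X.2).

Lemma tensor_comp_idl X Y (x : thom X Y) : tensor_comp (tensor_idm Y) x = x.
Proof.
elim/tensor_ind: x => [|x y IHx IHy|f g]; first exact: tcomp0r.
  by rewrite tcompDr IHx IHy.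
by rewrite tensor_compE !mcomp_idl.
Qed.

Lemma tensor_comp_idr X Y (x : thom X Y) : tensor_comp x (tensor_idm X) = x.
Proof.
elim/tensor_ind: x => [|x y IHx IHy|f g]; first exact: tcomp0l.
  by rewrite tcompDl IHx IHy.
by rewrite tensor_compE !mcomp_idr.
Qed.

Lemma tensor_compA X Y Z T (x : thom Z T) (y : thom Y Z) (z : thom X Y) :
  tensor_comp x (tensor_comp y z) = tensor_comp (tensor_comp x y) z.
Proof.
elim/tensor_ind: x => [|x x' IHx IHx'|f g]; first by rewrite !tcomp0l.
  by rewrite !tcompDl IHx IHx'.
elim/tensor_ind: y => [|y y' IHy IHy'|f' g']; first by rewrite !(tcomp0l, tcomp0r).
  by rewrite !(tcompDl, tcompDr) IHy IHy'.
elim/tensor_ind: z => [|z z' IHz IHz'|f'' g'']; first by rewrite !tcomp0r.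
  by rewrite !tcompDr IHz IHz'.
by rewrite !tensor_compE !mcompA.
Qed.

Definition tensor_cat : lincat k (O * P) := {|
  mor := thom;
  idm := tensor_idm;
  mcomp := tensor_comp;
  mcomp_linearl := tensor_comp_linearl;
  mcomp_linearr := tensor_comp_linearr;
  mcomp_idl := tensor_comp_idl;
  mcomp_idr := tensor_comp_idr;
  mcompA := tensor_compA
|}.

End TensorCat.

Section Sieves.
Variables (k : comPzRingType) (O : Type) (c : lincat k O).

Record sieve (A : O) := Sieve {
  sieve_at :> forall A', submodClosed (mor c A' A);
  sieve_comp : forall A' A'' (f : mor c A' A) (g : mor c A'' A'),
    f \in sieve_at A' -> mcomp c f g \in sieve_at A''
}.

Definition sieve_sub A (R S : sieve A) : Prop :=
  forall A' (f : mor c A' A), f \in R A' -> f \in S A'.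

Lemma sieve_ext A (R S : sieve A) : sieve_sub R S -> sieve_sub S R -> R = S.
Proof.
case: R S => [R Rc] [S Sc] RS SR.
have E : R = S.
  apply: functional_extensionality_dep => A'; apply: submod_ext => f.
  by apply/idP/idP; [apply: RS | apply: SR].
by subst S; rewrite (Prop_irrelevance Rc Sc).
Qed.

Section OfProp.
Variables (A : O) (P : forall A', mor c A' A -> Prop).
Hypothesis P0 : forall A', P (0 : mor c A' A).
Hypothesis PL : forall A' r (f g : mor c A' A), P f -> P g -> P (r *: f + g).
Hypothesis PC : forall A' A'' (f : mor c A' A) (g : mor c A'' A'),
  P f -> P (mcomp c f g).

Definition sieve_of : sieve A.
Proof.
exists (fun A' => submod_of (@P0 A') (@PL A')) => A' A'' f g /submod_ofP Pf.
by apply/submod_ofP; apply: PC.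
Defined.

Lemma sieve_ofP A' (f : mor c A' A) : reflect (P f) (f \in sieve_of A').
Proof. exact: submod_ofP. Qed.

End OfProp.

Definition max_sieve (A : O) : sieve A :=
  @sieve_of A (fun _ _ => True) (fun _ => I) (fun _ _ _ _ _ _ => I)
    (fun _ _ _ _ _ => I).

Definition pull_sieve (A A' : O) (f : mor c A' A) (R : sieve A) : sieve A'.
Proof.
apply: (@sieve_of A' (fun A'' g => mcomp c f g \in R A'')).
- by move=> A''; rewrite mcompm0; apply: rpred0.
- by move=> A'' r g h Rg Rh; rewrite mcomp_linearr rpredD ?rpredZ.
- by move=> A'' A3 g h Rg; rewrite mcompA; apply: sieve_comp.
Defined.

Definition gen_sieve (A : O) (G : forall A', mor c A' A -> Prop) : sieve A.
Proof.
apply: (@sieve_of A (fun A' f => forall R : sieve A,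
  (forall B (g : mor c B A), G B g -> g \in R B) -> f \in R A')).
- by move=> A' R _; apply: rpred0.
- by move=> A' r f g Rf Rg R GR; rewrite rpredD ?rpredZ ?Rf ?Rg.
- by move=> A' A'' f g Rf R GR; apply/sieve_comp/Rf.
Defined.

Definition sieve_family := forall A, sieve A -> Prop.

Definition is_topology (T : sieve_family) : Prop :=
  [/\ forall A, T A (max_sieve A),
      forall A A' (R : sieve A) (f : mor c A' A),
        T A R -> T A' (pull_sieve f R)
    & forall A (R S : sieve A), T A R ->
        (forall A' (f : mor c A' A), f \in R A' -> T A' (pull_sieve f S)) ->
        T A S].

Record linear_topology := LinTopology {
  covering :> forall A, sieve A -> Prop;
  covering_topology : is_topology covering
}.

Definition gen_covering (G : sieve_family) : sieve_family := fun A R =>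
  forall T : sieve_family,
    is_topology T -> (forall B (S : sieve B), G B S -> T B S) -> T A R.

Lemma gen_covering_topology G : is_topology (gen_covering G).
Proof.
split.
- by move=> A T [].
- move=> A A' R f GR T topT GT; have [_ + _] := topT; apply; exact: GR.
- move=> A R S GR GS T topT GT; have [_ _ glue] := topT.
  by apply: glue (GR T topT GT) _ => A' f Rf; apply: GS.
Qed.

Definition gen_topology (G : sieve_family) : linear_topology :=
  LinTopology (gen_covering_topology G).

End Sieves.

Arguments max_sieve {k O} c A.

Section Box.
Variables (k : comPzRingType) (O P : Type) (a : lincat k O) (b : lincat k P).

(* the component at X of the canonical map                                    *)
(* R (x) S -> (a (x) b)(-, (A, B))                                            *)
Definition box_map A B (R : sieve a A) (S : sieve b B) (X : O * P) :
    tensor (submod (R X.1)) (submod (S X.2)) -> mor (tensor_cat a b) X (A, B) :=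
  tensor_map (@submod_val _ _ (R X.1)) (@submod_val _ _ (S X.2)).

Lemma box_map_linear A B (R : sieve a A) (S : sieve b B) X :
  linear (@box_map A B R S X).
Proof.
by apply: tensor_lift_linear; apply: (tens_map_bilinear val val).
Qed.

Definition box_sieve A B (R : sieve a A) (S : sieve b B) :
  sieve (tensor_cat a b) (A, B).
Proof.
apply: (@sieve_of _ _ (tensor_cat a b) (A, B)
  (fun X f => exists t, box_map t = f :> mor (tensor_cat a b) X (A, B))).
- by move=> X; exists 0; apply: (lin0 (@box_map_linear A B R S X)).
- move=> X r _ _ [t <-] [t' <-]; exists (r *: t + t').
  by rewrite box_map_linear.
- move=> X Y _ g [t <-].
  have BD Z := linD (@box_map_linear A B R S Z).
  have B0 Z := lin0 (@box_map_linear A B R S Z).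
  have BT Z f h : @box_map A B R S Z (tens f h)
      = tens (submod_val f) (submod_val h).
    by apply: tensor_lift_tens; apply: (tens_map_bilinear val val).
  elim/tensor_ind: t => [|t t' [s Es] [s' Es']|f h].
  + by exists 0; rewrite !B0 mcomp0m.
  + by exists (s + s'); rewrite !BD mcompDl Es Es'.
  elim/tensor_ind: g => [|g g' [s Es] [s' Es']|f' h'].
  + by exists 0; rewrite B0 mcompm0.
  + by exists (s + s'); rewrite BD mcompDr Es Es'.
  exists (tens (Submod (sieve_comp f' (submod_valP f)))
               (Submod (sieve_comp h' (submod_valP h)))).
  by rewrite !BT; apply/esym; apply: tensor_compE.
Defined.

Inductive box_generator (Ta : linear_topology a) (Tb : linear_topology b) :
  sieve_family (tensor_cat a b) :=
| BoxLeft A B (R : sieve a A) :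
    Ta A R -> box_generator Ta Tb (box_sieve R (max_sieve b B))
| BoxRight A B (S : sieve b B) :
    Tb B S -> box_generator Ta Tb (box_sieve (max_sieve a A) S).

Definition box_topology (Ta : linear_topology a) (Tb : linear_topology b) :
  linear_topology (tensor_cat a b) := gen_topology (box_generator Ta Tb).

End Box.

Section ImageSieve.
Variables (k : comPzRingType) (O P : Type) (c : lincat k O) (d : lincat k P).
Variable phi : linfunctor c d.

Inductive image_generator C (S : sieve c C) :
    forall D, mor d D (phi C) -> Prop :=
| Image C' (f : mor c C' C) : f \in S C' -> image_generator S (fmor phi f).

Definition image_sieve C (S : sieve c C) : sieve d (phi C) :=
  gen_sieve (image_generator S).

Definition cocontinuous (Tc : linear_topology c) (Td : linear_topology d) :=
  forall C (R : sieve d (phi C)), Td (phi C) R ->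
    exists2 S : sieve c C, Tc C S & sieve_sub (image_sieve S) R.

Definition preimage_covering (Td : linear_topology d) : sieve_family c :=
  fun C S => Td (phi C) (image_sieve S).

End ImageSieve.

Section ZAlgebra.
Variable k : comPzRingType.

Record zalgebra := ZAlgebra {
  zcat :> lincat k int;
  zalgebra_pos : forall n m : int, n < m -> forall f : mor zcat n m, f = 0
}.

Definition tail_sieve (a : zalgebra) (m n : int) : sieve a m.
Proof.
apply: (@sieve_of _ _ a m (fun l f => n <= l \/ f = 0)).
- by move=> l; right.
- move=> l r f g [nl|->]; first by left.
  by case=> [nl|->]; [left | right; rewrite scaler0 addr0].
- move=> l p f g [nl|->]; last by right; apply: mcomp0m.
  have [lp|pl] := leP l p; first by left; apply: le_trans lp.
  by right; rewrite (zalgebra_pos pl g) mcompm0.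
Defined.

Inductive tail_generator (a : zalgebra) : sieve_family a :=
| Tail (m n : int) : m <= n -> tail_generator (tail_sieve a m n).

Definition tails_topology (a : zalgebra) : linear_topology a :=
  gen_topology (@tail_generator a).

Definition diag (n : int) : int * int := (n, n).

Definition diagonal (a b : zalgebra) : zalgebra.
Proof.
exists (full_restr diag (tensor_cat a b)) => n m nm f.
elim/tensor_ind: f => // [x y -> ->|f g]; first by rewrite addr0.
by rewrite (zalgebra_pos nm f); apply: bil0l; apply: tens_bilinear.
Defined.

Definition Delta (a b : zalgebra) : linfunctor (diagonal a b) (tensor_cat a b) :=
  full_restr_functor diag (tensor_cat a b).

End ZAlgebra.

(* Main.v *)
Require Import Defs.
From mathcomp Require Import all_boot all_order all_algebra.

(** For a functor [phi] from [c] to [d] and a topology [T] on [c], call a sieve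
    [R] on [X] push-covering if, for every [g : phi C -> X], the morphisms [f]
    of [c] with [g o phi f] in [R] form a [T]-covering sieve of [C].  These
    sieves form a topology on [d] ([push_covering_topology]), in fact the
    largest one for which [phi] is cocontinuous.  To prove cocontinuity for a
    topology given by generators, it is therefore enough to check that the
    generators are push-covering ([cocontinuous_gen]).

    For [Delta] the generators are the products of a covering sieve [R] of one
    factor with the maximal sieve of the other.  Let [g] be a morphism from
    [(n, n)] to [(A, B)].  It is a sum of pure tensors [u (x) v]; as finite
    intersections of covering sieves cover, one may take a single one, and then
    the pullback of the product of [R] and the maximal sieve contains the
    product of [u^-1 R] and the maximal sieve.  So all comes down to one fact,
    [diag_box_left] and its mirror image [diag_box_right]: if [R] is
    tails-covering on [n], the diagonal part of its product with the maximal
    sieve is tails-covering on [n].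

    Here [R] is any member of a generated topology, so an induction over the
    generation is needed.  The family of those [R] for which the diagonal part
    covers is not visibly stable under pullback, so the induction is run on the
    sieves all of whose pullbacks have this property ([transfer_covering]).
    Glueing for that family is again the reduction to pure tensors.  On a tail
    the claim is seen by hand: the pullback of a tail at [N] along a morphism
    from [l] contains the tail at [max l N], and a morphism of the diagonal
    algebra with source at least [N] is a sum of tensors of morphisms with that
    source ([diag_box_tail]).

    The inclusion of the preimage family in the tails topology is a formal
    consequence: [Delta] is fully faithful, so a sieve [S] is the restriction of
    the sieve generated by its image, and cocontinuity puts a covering sieve
    inside [S] ([preimage_covering_full]). *)

Set Implicit Arguments.
Unset Strict Implicit.
Unset Printing Implicit Defensive.

Import Order.TTheory GRing.Theory.
Local Open Scope ring_scope.

(** * Sieves and linear topologies *)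

Section Coverings.
Variables (k : comPzRingType) (O : Type) (c : lincat k O).

Lemma mem_pull_sieve A A' A'' (f : mor c A' A) (R : sieve c A)
    (g : mor c A'' A') :
  (g \in pull_sieve f R A'') = (mcomp c f g \in R A'').
Proof. exact/sieve_ofP/idP. Qed.

Lemma mem_max_sieve A A' (f : mor c A' A) : f \in max_sieve c A A'.
Proof. exact/sieve_ofP. Qed.

Lemma sub_max_sieve A (R : sieve c A) : sieve_sub R (max_sieve c A).
Proof. by move=> A' f _; apply: mem_max_sieve. Qed.

Lemma sub_pull_max A A' (f : mor c A' A) (R : sieve c A') :
  sieve_sub R (pull_sieve f (max_sieve c A)).
Proof. by move=> A'' g _; rewrite mem_pull_sieve mem_max_sieve. Qed.

Lemma gen_sieve_min A (G : forall A', mor c A' A -> Prop) (R : sieve c A) :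
    (forall A' (f : mor c A' A), G A' f -> f \in R A') ->
  sieve_sub (gen_sieve G) R.
Proof. by move=> GR A' f /sieve_ofP; apply. Qed.

Lemma mem_gen_sieve A (G : forall A', mor c A' A -> Prop) A' (f : mor c A' A) :
  G A' f -> f \in gen_sieve G A'.
Proof. by move=> Gf; apply/sieve_ofP => R; apply. Qed.

Variable T : linear_topology c.

Lemma covering_max A : T A (max_sieve c A).
Proof. by have [] := covering_topology T. Qed.

Lemma covering_pull A A' (R : sieve c A) (f : mor c A' A) :
  T A R -> T A' (pull_sieve f R).
Proof. by have [_ + _] := covering_topology T; apply. Qed.

Lemma covering_glue A (R S : sieve c A) :
  T A R -> (forall A' (f : mor c A' A), f \in R A' -> T A' (pull_sieve f S)) ->
  T A S.
Proof. by have [_ _] := covering_topology T; apply. Qed.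

(** Any sieve containing a covering one covers: pulled back along a member of
    the smaller sieve it becomes maximal, so glueing applies. *)
Lemma covering_sub A (R S : sieve c A) : sieve_sub R S -> T A R -> T A S.
Proof.
move=> RS TR; apply: (covering_glue TR) => A' f Rf.
rewrite (_ : pull_sieve f S = max_sieve c A'); first exact: covering_max.
apply: sieve_ext => A'' g _; first exact: mem_max_sieve.
by rewrite mem_pull_sieve sieve_comp ?RS.
Qed.

Lemma covering_inter A (R S Q : sieve c A) :
  T A R -> T A S ->
  (forall A' (f : mor c A' A), f \in R A' -> f \in S A' -> f \in Q A') ->
  T A Q.
Proof.
move=> TR TS RSQ; apply: (covering_glue TR) => A' f Rf.
apply: covering_sub (covering_pull f TS).
by move=> A'' g; rewrite !mem_pull_sieve; apply/RSQ/sieve_comp.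
Qed.

End Coverings.

(** Induction principle for a monotone map [D] from sieves of [a] to sieves of
    [c] that need not commute with pullbacks: the sieves all of whose pullbacks
    have a covering image under [D] form a topology as soon as [D] is
    compatible with glueing. *)
Lemma transfer_covering (k : comPzRingType) (O : Type) (a c : lincat k O)
    (T : linear_topology c) (G : sieve_family a)
    (D : forall A, sieve a A -> sieve c A) :
    (forall A (R S : sieve a A), sieve_sub R S -> sieve_sub (D A R) (D A S)) ->
    (forall A, T A (D A (max_sieve a A))) ->
    (forall A (R S : sieve a A) A' (h : mor c A' A), h \in D A R A' ->
      (forall f : mor a A' A, f \in R A' -> T A' (D A' (pull_sieve f S))) ->
      T A' (pull_sieve h (D A S))) ->
    (forall A (R : sieve a A), G A R ->
      forall A' (f : mor a A' A), T A' (D A' (pull_sieve f R))) ->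
  forall A (R : sieve a A), gen_topology G A R -> T A (D A R).
Proof.
move=> D_sub D_max D_glue D_gen A R GR.
pose F : sieve_family a := fun A R =>
  forall A' (f : mor a A' A), T A' (D A' (pull_sieve f R)).
suff /(_ A (idm a A)) : F A R.
  by apply: covering_sub; apply: D_sub => B g; rewrite mem_pull_sieve mcomp_idl.
apply: GR => //; split=> {A R}.
- move=> A A' f; apply: covering_sub (D_max A'); apply: D_sub => B g _.
  by rewrite mem_pull_sieve mem_max_sieve.
- move=> A A' R f FR A'' g; apply: covering_sub (FR A'' (mcomp a f g)).
  by apply: D_sub => B h; rewrite !mem_pull_sieve mcompA.
- move=> A R S FR FS A' f; apply: (covering_glue (FR A' f)) => A'' h DRh.
  apply: D_glue DRh _ => g; rewrite mem_pull_sieve => Rfg.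
  apply: covering_sub (FS _ _ Rfg _ (idm a A'')); apply: D_sub => B u.
  by rewrite !mem_pull_sieve mcomp_idl mcompA.
Qed.

(** * Pushing a topology forward along a functor *)

Section Restriction.
Variables (k : comPzRingType) (O P : Type) (c : lincat k O) (d : lincat k P).
Variable phi : linfunctor c d.

Definition restr_sieve C (R : sieve d (phi C)) : sieve c C.
Proof.
apply: (@sieve_of k O c C (fun C' f => fmor phi f \in R (phi C'))).
- by move=> C'; rewrite (lin0 (@fmor_linear _ _ _ _ _ phi C' C)) rpred0.
- by move=> C' r f g Rf Rg; rewrite fmor_linear rpredD ?rpredZ.
- by move=> C' C'' f g Rf; rewrite fmor_comp sieve_comp.
Defined.

Lemma mem_restr_sieve C (R : sieve d (phi C)) C' (f : mor c C' C) :
  (f \in restr_sieve R C') = (fmor phi f \in R (phi C')).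
Proof. exact/sieve_ofP/idP. Qed.

Lemma image_restr_sub C (R : sieve d (phi C)) :
  sieve_sub (image_sieve phi (restr_sieve R)) R.
Proof.
by apply: gen_sieve_min => _ _ [C' g]; rewrite mem_restr_sieve.
Qed.

(** The quantification over all [g] makes stability under pullback automatic. *)
Definition push_covering (T : linear_topology c) : sieve_family d := fun X R =>
  forall C (g : mor d (phi C) X), T C (restr_sieve (pull_sieve g R)).

Lemma push_covering_topology (T : linear_topology c) :
  is_topology (push_covering T).
Proof.
split.
- move=> X C g; apply: covering_sub (covering_max T C) => C' f _.
  by rewrite mem_restr_sieve mem_pull_sieve mem_max_sieve.
- move=> X Y R f TR C g; apply: covering_sub (TR C (mcomp d f g)) => C' h.
  by rewrite !(mem_restr_sieve, mem_pull_sieve) mcompA.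
- move=> X R S TR TS C g; apply: (covering_glue (TR C g)) => C' f.
  rewrite mem_restr_sieve mem_pull_sieve => Rgf.
  (* The pullback of [S] along [g o phi f] is push-covering; testing it on the
     identity of [phi C'] is what glueing asks for. *)
  apply: covering_sub (TS _ _ Rgf C' (idm d (phi C'))) => C'' h.
  by rewrite !(mem_restr_sieve, mem_pull_sieve) fmor_comp mcomp_idl mcompA.
Qed.

(** The generated topology is contained in the push-covering one, whose
    condition at the identity of [phi C] is exactly cocontinuity. *)
Lemma cocontinuous_gen (T : linear_topology c) (G : sieve_family d) :
    (forall X (R : sieve d X), G X R -> push_covering T R) ->
  cocontinuous phi T (gen_topology G).
Proof.
move=> GT C R GR; exists (restr_sieve R); last exact: image_restr_sub.
have := GR _ (push_covering_topology T) GT C (idm d (phi C)).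
apply: covering_sub => C' f.
by rewrite !mem_restr_sieve mem_pull_sieve mcomp_idl.
Qed.

End Restriction.

Arguments restr_sieve {k O P c d} phi {C} R.

(** The generated sieve contains the composites [f o g] with [f] in [S] and [g]
    any morphism of [d]; when [g] runs between objects of the full subcategory
    it belongs to that subcategory, so [f o g] is already in [S]. *)
Lemma image_full_restr (k : comPzRingType) (O P : Type) (phi : O -> P)
    (d : lincat k P) C (S : sieve (full_restr phi d) C) C'
    (f : mor (full_restr phi d) C' C) :
  f \in image_sieve (full_restr_functor phi d) S (phi C') -> f \in S C'.
Proof.
(* The largest sieve on [phi C] whose restriction to the subcategory is
   contained in [S]. *)
have @U : sieve d (phi C).
  apply: (@sieve_of k P d (phi C) (fun X h => forall B (g : mor d (phi B) X),
    mcomp d h g \in S B)).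
  - by move=> X B g; rewrite mcomp0m rpred0.
  - move=> X r h h' Sh Sh' B g.
    by rewrite mcomp_linearl rpredD ?rpredZ ?Sh ?Sh'.
  - by move=> X Y h h' Sh B g; rewrite -mcompA Sh.
have SU : sieve_sub (image_sieve (full_restr_functor phi d) S) U.
  apply: gen_sieve_min => _ _ [B g Sg]; apply/sieve_ofP => B' g'.
  exact: (@sieve_comp _ _ (full_restr phi d)).
by move/SU/sieve_ofP/(_ _ (idm d (phi C'))); rewrite mcomp_idr.
Qed.

Lemma preimage_covering_full (k : comPzRingType) (O P : Type) (phi : O -> P)
    (d : lincat k P) (Tc : linear_topology (full_restr phi d))
    (Td : linear_topology d) :
    cocontinuous (full_restr_functor phi d) Tc Td ->
  forall C S, preimage_covering (full_restr_functor phi d) Td S -> Tc C S.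
Proof.
move=> cocont C S /cocont[S' TS' sub]; apply: covering_sub TS' => C' f Sf.
apply/image_full_restr/sub/mem_gen_sieve.
exact: (@Image _ _ _ _ _ (full_restr_functor phi d)).
Qed.

(** * Products of sieves *)

Section Box.
Variables (k : comPzRingType) (O P : Type) (a : lincat k O) (b : lincat k P).
Local Notation ab := (tensor_cat a b).

Lemma mem_box_tens A B (R : sieve a A) (S : sieve b B) X
    (f : mor a X.1 A) (g : mor b X.2 B) :
  f \in R X.1 -> g \in S X.2 ->
  (tens f g : mor ab X (A, B)) \in box_sieve R S X.
Proof.
move=> Rf Sg; apply/sieve_ofP; exists (tens (Submod Rf) (Submod Sg)).
by apply: tensor_lift_tens; apply: (tens_map_bilinear val val).
Qed.

(** Membership is defined by a tensor of submodules; in practice it means being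
    a sum of pure tensors of members. *)
Lemma box_sieve_ind A B (R : sieve a A) (S : sieve b B) X
    (Q : mor ab X (A, B) -> Prop) :
    Q 0 -> (forall f g, Q f -> Q g -> Q (f + g)) ->
    (forall f g, f \in R X.1 -> g \in S X.2 -> Q (tens f g)) ->
  forall h, h \in box_sieve R S X -> Q h.
Proof.
move=> Q0 QD Qt h /sieve_ofP[t <-] {h}.
have lin := @box_map_linear k O P a b A B R S X.
elim/tensor_ind: t => [|t t' Qt1 Qt2|f g]; first by rewrite (lin0 lin).
  by rewrite (linD lin); apply: QD.
rewrite /box_map /tensor_map tensor_lift_tens.
  by apply: Qt; apply: submod_valP.
exact: (tens_map_bilinear val val).
Qed.

Lemma box_sieve_sub A B (R R' : sieve a A) (S S' : sieve b B) :
    sieve_sub R R' -> sieve_sub S S' ->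
  sieve_sub (box_sieve R S) (box_sieve R' S').
Proof.
move=> RR' SS' X h; elim/box_sieve_ind => [|f g|f g Rf Sg].
- exact: rpred0.
- exact: rpredD.
- by apply: mem_box_tens; [apply: RR' | apply: SS'].
Qed.

Lemma box_sieve_max A B X (h : mor ab X (A, B)) :
  h \in box_sieve (max_sieve a A) (max_sieve b B) X.
Proof.
elim/tensor_ind: h => [|f g Hf Hg|f g]; first exact: rpred0.
  exact: rpredD.
by apply: mem_box_tens; apply: mem_max_sieve.
Qed.

Lemma pull_box_tens A B A' B' (R : sieve a A) (S : sieve b B)
    (f : mor a A' A) (g : mor b B' B) :
  sieve_sub (box_sieve (pull_sieve f R) (pull_sieve g S))
    (pull_sieve (tens f g : mor ab (A', B') (A, B)) (box_sieve R S)).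
Proof.
move=> X h; elim/box_sieve_ind => [|u v|u v Ru Sv].
- exact: rpred0.
- exact: rpredD.
- rewrite mem_pull_sieve.
  have -> : mcomp ab (tens f g : mor ab (A', B') (A, B))
      (tens u v : mor ab X (A', B'))
      = tens (mcomp a f u) (mcomp b g v) by apply: tensor_compE.
  by apply: mem_box_tens; rewrite -mem_pull_sieve.
Qed.

(** Reduction to pure tensors: the pullback of a sieve along a sum contains the
    intersection of the pullbacks along the terms, and along zero it is
    maximal. *)
Lemma covering_pull_box (N : Type) (c : lincat k N) (phi : linfunctor c ab)
    (T : linear_topology c) C A B (R R' : sieve a A) (S S' : sieve b B)
    (h : mor ab (phi C) (A, B)) :
    h \in box_sieve R S (phi C) ->
    (forall (f : mor a (phi C).1 A) (g : mor b (phi C).2 B),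
      f \in R _ -> g \in S _ ->
      T C (restr_sieve phi (pull_sieve (tens f g : mor ab (phi C) (A, B))
        (box_sieve R' S')))) ->
  T C (restr_sieve phi (pull_sieve h (box_sieve R' S'))).
Proof.
move=> + HT; elim/box_sieve_ind => [|u v Tu Tv|f g Rf Sg].
- apply: covering_sub (covering_max T C) => C' f _.
  by rewrite mem_restr_sieve mem_pull_sieve mcomp0m rpred0.
- apply: (covering_inter Tu Tv) => C' f.
  by rewrite !(mem_restr_sieve, mem_pull_sieve) mcompDl => ? ?; apply: rpredD.
- exact: HT.
Qed.

End Box.

(** * The diagonal of a product of sieves *)

(** The maximum with [l] keeps the smaller sieve among the generators of the
    tails topology, which are tails of [a(-, l)] starting at [l] or later. *)
Lemma pull_tail_sub (k : comPzRingType) (a : zalgebra k) (m n l : int)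
    (f : mor a l m) :
  sieve_sub (tail_sieve a l (Order.max l n)) (pull_sieve f (tail_sieve a m n)).
Proof.
move=> p g /sieve_ofP tg; rewrite mem_pull_sieve; apply/sieve_ofP.
case: tg => [|->]; last by right; apply: mcompm0.
by rewrite ge_max => /andP[_ np]; left.
Qed.

Section Diagonal.
Variables (k : comPzRingType) (a b : zalgebra k).
Local Notation Tc := (tails_topology (diagonal a b)).

Definition diag_box (n : int) (R : sieve a n) (S : sieve b n) :
    sieve (diagonal a b) n :=
  restr_sieve (Delta a b) (box_sieve R S).

Lemma mem_diag_box n (R : sieve a n) (S : sieve b n) l
    (h : mor (diagonal a b) l n) :
  (h \in diag_box R S l) =
    ((h : mor (tensor_cat a b) (l, l) (n, n)) \in box_sieve R S (l, l)).
Proof. exact: mem_restr_sieve. Qed.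

Lemma diag_box_sub n (R R' : sieve a n) (S S' : sieve b n) :
  sieve_sub R R' -> sieve_sub S S' -> sieve_sub (diag_box R S) (diag_box R' S').
Proof.
by move=> RR' SS' l h; rewrite !mem_diag_box; apply: box_sieve_sub.
Qed.

Lemma diag_box_max n : Tc n (diag_box (max_sieve a n) (max_sieve b n)).
Proof.
apply: covering_sub (covering_max Tc n) => l h _.
by rewrite mem_diag_box box_sieve_max.
Qed.

Lemma covering_pull_diag_box A B (R R' : sieve a A) (S S' : sieve b B) n
    (h : mor (tensor_cat a b) (n, n) (A, B)) :
    h \in box_sieve R S (n, n) ->
    (forall (f : mor a n A) (g : mor b n B), f \in R n -> g \in S n ->
      Tc n (diag_box (pull_sieve f R') (pull_sieve g S'))) ->
  Tc n (restr_sieve (Delta a b) (C := n) (pull_sieve h (box_sieve R' S'))).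
Proof.
move=> RSh HT.
apply: (covering_pull_box (phi := Delta a b) (C := n)) RSh _ => f g Rf Sg.
apply: covering_sub (HT f g Rf Sg) => l u.
rewrite mem_diag_box mem_restr_sieve; exact: pull_box_tens.
Qed.

(** The glueing hypothesis of [transfer_covering], for both factors at once. *)
Lemma covering_glue_diag_box n (R R' : sieve a n) (S S' : sieve b n) l
    (h : mor (diagonal a b) l n) :
    h \in diag_box R S l ->
    (forall (f : mor a l n) (g : mor b l n), f \in R l -> g \in S l ->
      Tc l (diag_box (pull_sieve f R') (pull_sieve g S'))) ->
  Tc l (pull_sieve h (diag_box R' S')).
Proof.
rewrite mem_diag_box => RSh /(covering_pull_diag_box RSh).
by apply: covering_sub => p u; rewrite !(mem_restr_sieve, mem_pull_sieve).
Qed.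

(** Both factors of a pure tensor have the same source in the diagonal algebra,
    so one bound on this source puts them in both tails. *)
Lemma diag_box_tail n N : n <= N ->
  Tc n (diag_box (tail_sieve a n N) (tail_sieve b n N)).
Proof.
move=> nN; have : Tc n (tail_sieve (diagonal a b) n N) by move=> F _; apply.
apply: covering_sub => l h /sieve_ofP[Nl|->]; last exact: rpred0.
rewrite mem_diag_box.
elim/tensor_ind: h => [|f g Hf Hg|f g]; first exact: rpred0.
  exact: rpredD.
by apply: mem_box_tens; apply/sieve_ofP; left.
Qed.

Lemma diag_box_left n (R : sieve a n) :
  tails_topology a n R -> Tc n (diag_box R (max_sieve b n)).
Proof.
apply: (transfer_covering (T := Tc)
  (D := fun n R => diag_box R (max_sieve b n))).
- by move=> m Q Q' QQ'; apply: diag_box_sub.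
- exact: diag_box_max.
- move=> m Q S l h Qh HS; apply: covering_glue_diag_box Qh _ => f g Qf _.
  apply: covering_sub (HS f Qf); apply: diag_box_sub => //; exact: sub_pull_max.
- move=> _ _ [m N mN] l f.
  have lN : l <= Order.max l N by rewrite le_max lexx.
  apply: covering_sub (diag_box_tail lN); apply: diag_box_sub.
    exact: pull_tail_sub.
  exact: sub_max_sieve.
Qed.

Lemma diag_box_right n (S : sieve b n) :
  tails_topology b n S -> Tc n (diag_box (max_sieve a n) S).
Proof.
apply: (transfer_covering (T := Tc)
  (D := fun n S => diag_box (max_sieve a n) S)).
- by move=> m Q Q' QQ'; apply: diag_box_sub.
- exact: diag_box_max.
- move=> m Q S' l h Qh HS; apply: covering_glue_diag_box Qh _ => f g _ Qg.
  apply: covering_sub (HS g Qg); apply: diag_box_sub => //; exact: sub_pull_max.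
- move=> _ _ [m N mN] l f.
  have lN : l <= Order.max l N by rewrite le_max lexx.
  apply: covering_sub (diag_box_tail lN); apply: diag_box_sub.
    exact: sub_max_sieve.
  exact: pull_tail_sub.
Qed.

Lemma box_generator_push X (R : sieve (tensor_cat a b) X) :
  box_generator (tails_topology a) (tails_topology b) R ->
  push_covering (Delta a b) Tc R.
Proof.
case=> A B Q TQ n h.
all: apply: covering_pull_diag_box (box_sieve_max h) _ => f g _ _.
- apply: covering_sub (diag_box_left (covering_pull f TQ)).
  by apply: diag_box_sub => //; exact: sub_pull_max.
- apply: covering_sub (diag_box_right (covering_pull g TQ)).
  by apply: diag_box_sub => //; exact: sub_pull_max.
Qed.

End Diagonal.

Theorem proposition4p5 (k : comPzRingType) (a b : zalgebra k) :
  cocontinuous (Delta a b) (tails_topology (diagonal a b))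
    (box_topology (tails_topology a) (tails_topology b)) /\
  (forall (n : int) (S : sieve (diagonal a b) n),
     preimage_covering (Delta a b)
       (box_topology (tails_topology a) (tails_topology b)) S ->
     tails_topology (diagonal a b) n S).
Proof.
have cocont : cocontinuous (Delta a b) (tails_topology (diagonal a b))
    (box_topology (tails_topology a) (tails_topology b)).
  exact: cocontinuous_gen (@box_generator_push k a b).
by split=> // n S; apply: (preimage_covering_full cocont).
Qed.
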